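(* Let $G$ be a connected graph with asymptotic growth rate $\mathrm{ar}(G)=\rho<\infty$. For every $\epsilon>0$, there exists an injective map $f\colon V(G)\to\mathbb{Z}^n$, where $n=O_\epsilon(\rho)$, such that for all $u,v\in V(G)$, $$\mathrm{dist}_\infty(f(u),f(v))\,\le\,\max\{\mathrm{dist}_G(u,v),\,O_{G,\epsilon}(1)\}\quad\text{and}\quad\mathrm{dist}_\infty(f(u),f(v))\,=\,\Omega_{G,\epsilon}\big(\mathrm{dist}_G(u,v)^{1-\epsilon}\big).$$
   Context: Graphs are undirected and simple, possibly infinite. $\mathrm{dist}_G$ is the graph metric and $B_G(u,r)$ is the closed ball of radius $r$ around $u$ in this metric. The growth function is $\gamma_G(r)=\sup_{u\in V(G)}|B_G(u,r)|$; for $r\ge 1$ put $\rho(G,r)=\log\gamma_G(r)/\log(r+1)$. The asymptotic growth rate is $\mathrm{ar}(G)=\limsup_{r\to\infty}\rho(G,r)$. On $\mathbb{Z}^n$, $\mathrm{dist}_\infty(x,y)=\|x-y\|_\infty$; this is the graph metric of the $n$-dimensional grid with diagonals, i.e. the graph with vertex set $\mathbb{Z}^n$ in which $x,y$ are adjacent if and only if $\|x-y\|_\infty=1$. $O$ and $\Omega$ are the standard asymptotic notation, and subscripts indicate what the implied constants may depend on. Thus $n=O_\epsilon(\rho)$ means $n\le C_\epsilon\,\rho$ with $C_\epsilon$ depending only on $\epsilon$; $O_{G,\epsilon}(1)$ stands for a constant depending only on $G$ and $\epsilon$; and the $\Omega_{G,\epsilon}$ bound means that there are constants $c>0$ and $R\ge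 1$ depending on $G$ and $\epsilon$ such that $\mathrm{dist}_\infty(f(u),f(v))\ge c\,\mathrm{dist}_G(u,v)^{1-\epsilon}$ whenever $\mathrm{dist}_G(u,v)\ge R$.
   Formalization: For finite graphs ρ = 0, so n = O_ε(ρ) would force n = 0 and no injective map exists once there are two vertices; when ρ = 0 the formal theorem allows n ≤ 1 instead, and keeps n ≤ C_ε ρ whenever ρ ≠ 0. *)

(* Defs.v *)
From HB Require Import structures.
From mathcomp Require Import all_boot all_order all_algebra.
From mathcomp Require Import all_classical all_reals all_analysis.

Set Implicit Arguments.
Unset Strict Implicit.
Unset Printing Implicit Defensive.

Import Order.TTheory GRing.Theory Num.Theory.

Local Open Scope classical_set_scope.
Local Open Scope ring_scope.

Record sgraph := SGraph {
  vertex :> choiceType;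
  adj : rel vertex;
  adj_sym : symmetric adj;
  adj_irr : irreflexive adj }.

Definition walk (G : sgraph) (k : nat) (u v : G) : Prop :=
  exists p : seq G, [/\ path (@adj G) u p, last u p = v & size p = k].

Definition reachable (G : sgraph) (u v : G) : Prop := exists k, walk k u v.

Definition gconnected (G : sgraph) : Prop :=
  [set: G] !=set0 /\ forall u v : G, reachable u v.

(* The default value 0 is only taken when v is not reachable from u. *)
Definition gdist (G : sgraph) (u v : G) : nat :=
  xget 0%N [set k | walk k u v /\ forall j, walk j u v -> (k <= j)%N].

Definition gball (G : sgraph) (u : G) (r : nat) : set G :=
  [set v | reachable u v /\ (gdist u v <= r)%N].

(* Balls may be infinite, and their sizes unbounded: values are in \bar R. *)
Definition growth (R : realType) (G : sgraph) (r : nat) : \bar R :=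
  ereal_sup [set counting (gball u r) | u in [set: G]].

(* Only meaningful for r >= 1; the value at r = 0 does not affect the limsup. *)
Definition growth_rate (R : realType) (G : sgraph) (r : nat) : \bar R :=
  (lne (growth R G r) / (ln r.+1%:R)%:E)%E.

Definition asymptotic_growth_rate (R : realType) (G : sgraph) : \bar R :=
  limn_esup (growth_rate R G).

Definition distinf (n : nat) (x y : 'rV[int]_n) : nat :=
  (\max_(i < n) absz (x ord0 i - y ord0 i)%R)%N.

(* Main.v *)
Require Import Defs.
From mathcomp Require Import all_boot all_order all_algebra.
From mathcomp Require Import all_classical all_reals all_analysis.
From mathcomp Require Import finmap zify ring lra.

(** A finite connected graph has growth rate 0 and is embedded by numbering its
    vertices. An infinite one has [1 <= rho], and [finite_gball] and
    [graph_growth] turn it into a countable metric space with integer distances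
    in which every ball of large radius [t] has at most [t.+1 ^ D] points, where
    [D <= 3 * rho] is a natural number. It remains to find [O(D)] real functions
    that are Lipschitz with constant 1/2, one of which always differs by about
    [dist ^ (1 - eps)] between two distant points. Their integer parts are the
    coordinates: rounding costs at most 1, hence only matters at distance at most
    2. A last coordinate, a bounded colouring that distinguishes all points at
    small distance ([bounded_colouring]), makes the map injective.

    A scale is given by an integer [Q], and deals with the pairs of points at
    distance between [Q ^ p.+3] and [Q ^ p.+4]. For large [Q] there are [n]
    functions, where [n = O(p D)] does not depend on [Q], that are 1-Lipschitz and
    at most [Q ^ p.+1], and one of which differs by [Q ^ p] at least on each pair
    ([single_scale]). They are found one by one, each of them dealing with all but a proportion [4 / Q] of the pairs left
    by the previous ones, and this in every region of the space
    ([separation_round]). Since the relevant regions contain at most [Q ^ (n - 1)]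
    pairs at first, and [4 ^ n < Q], none is left after [n] rounds ([separating_functions]). A round carves
    balls out of the space in the order of an enumeration. By region growing
    ([small_increment]) the radius can be chosen so that only a proportion
    [1 / Q] of the pairs carved at this step start in the outer shell of the
    ball; the inner part, the core, gets one of [Q] labels, chosen so that a
    proportion at most [1 / Q] of its pairs lead to an earlier core with the same
    label. Cores are far from each other thanks to the shells, so that the labels,
    multiplied by [Q ^ p], extend to a 1-Lipschitz function ([lip_extension]).

    The scales are [Q = 2 ^ ((P + j) * 2 ^ l)] with [j < P] and [l] arbitrary, and
    together they deal with all large distances ([scale_cover]). The functions of
    all scales with the same [j] are divided by [Q ^ 5] and added. In such a sum,
    [Q] is squared from one term to the next: the terms of lower scales are too
    small, and the terms of higher scales too slowly varying, to spoil the
    separation obtained at the scale of a given pair ([glue_separates]). There are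
    [P] values of [j], and [P] depends on [eps] only, which leaves
    [P * n + 1 = O(rho)] coordinates. *)

Set Implicit Arguments.
Unset Strict Implicit.
Unset Printing Implicit Defensive.

Import Order.TTheory GRing.Theory Num.Theory.
Import numFieldNormedType.Exports.

(** * Separating the pairs of points at one scale *)

Lemma leq_sum_sub (T : eqType) (s1 s2 : seq T) (P1 P2 : pred T) (F : T -> nat) :
  uniq s1 -> (forall x, x \in s1 -> P1 x -> (x \in s2) && P2 x) ->
  \sum_(x <- s1 | P1 x) F x <= \sum_(x <- s2 | P2 x) F x.
Proof.
move=> u1 sub; rewrite -(big_filter s1) -(big_filter s2).
have {u1} : uniq (seq.filter P1 s1) by rewrite filter_uniq.
have {sub} : {subset seq.filter P1 s1 <= seq.filter P2 s2}.
  by move=> x; rewrite !mem_filter => /andP[Px xs]; rewrite andbC sub.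
move: (seq.filter P1 s1) (seq.filter P2 s2) => {}s1.
elim: s1 => [|x s1 IH] {}s2 sub /=; first by rewrite big_nil.
move=> /andP[xs1 u1]; rewrite big_cons [leqRHS](big_rem x) ?sub ?mem_head //=.
rewrite leq_add2l IH // => y ys1; have := sub y; rewrite inE ys1 orbT.
move=> /(_ isT); rewrite (perm_mem (perm_to_rem (sub x (mem_head _ _)))) inE.
by case: eqP => // yx; rewrite -yx ys1 in xs1.
Qed.

(** Region growing: if all the increments up to [Q * M] were large, the sequence
    would double every [Q] steps. *)
Lemma small_increment (f : nat -> nat) (Q M : nat) : {homo f : i j / i <= j} ->
  0 < Q -> f (Q * M).+1 < 2 ^ M ->
  exists2 j, j <= Q * M & Q * (f j.+1 - f j) <= f j.+1.
Proof.
move=> fm Q0 fM.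
(* Bernoulli's inequality for [1 + 1 / Q], without denominators *)
have bern k : Q ^ k * (Q + k) <= Q.+1 ^ k * Q.
  by elim: k => [|k IH]; [rewrite addn0|rewrite !expnS; nia].
have dbl : 2 * Q ^ Q <= Q.+1 ^ Q.
  by rewrite -(leq_pmul2r Q0); have := bern Q; nia.
apply: contrapT => nex.
have big j : j <= Q * M -> f j.+1 < Q * (f j.+1 - f j).
  by move=> jM; rewrite ltnNge; apply/negP => le; apply: nex; exists j.
have f1 : 0 < f 1 by have := big 0 isT; case: (f 1) => //; rewrite sub0n muln0.
have step j : j <= Q * M -> Q.+1 ^ j <= Q ^ j * f j.+1.
  elim: j => [|j IH] jM; first by rewrite !expn0 mul1n.
  have jM' : j <= Q * M by apply: ltnW.
  have {IH} := IH jM'; have := big j.+1 jM; have := fm j.+1 j.+2 (leqnSn _).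
  rewrite mulnBr => f12 big' IH.
  have : Q.+1 * f j.+1 <= Q * f j.+2 by nia.
  by rewrite !expnS; nia.
have := step _ (leqnn _); rewrite !expnM leqNgt => /negP; apply.
apply: (@leq_trans ((2 * Q ^ Q) ^ M)); last by case: (M) => // M'; rewrite leq_exp2r.
by rewrite expnMn mulnC ltn_pmul2r // !expn_gt0 Q0.
Qed.

Lemma pigeonhole_sum (f : nat -> nat) (Q S : nat) : 0 < Q ->
  \sum_(m < Q) f m <= S -> exists2 m, m < Q & Q * f m <= S.
Proof.
move=> Q0 le; apply: contrapT => nex.
have big m : m < Q -> S < Q * f m.
  by move=> mQ; rewrite ltnNge; apply/negP => ?; apply: nex; exists m.
have : \sum_(m < Q) S.+1 <= Q * \sum_(m < Q) f m.
  by rewrite big_distrr leq_sum //= => i _; apply: big.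
by rewrite sum_nat_const card_ord; nia.
Qed.

(** A countable metric space with integer distances and finite balls: [cball u r]
    lists the closed ball and [en] enumerates the space. *)
Record lfspace := LFSpace {
  pt :> choiceType;
  dst : pt -> pt -> nat;
  dst_eq0 : forall u v, (dst u v == 0) = (u == v);
  dstC : forall u v, dst u v = dst v u;
  dst_tri : forall u v w, dst u w <= dst u v + dst v w;
  cball : pt -> nat -> seq pt;
  cball_uniq : forall u r, uniq (cball u r);
  mem_cball : forall u r v, (v \in cball u r) = (dst u v <= r);
  en : nat -> pt;
  en_surj : forall v, exists k, en k = v }.

Section Space.
Context (X : lfspace).
Implicit Types (u v w x : X) (P : rel X).

Lemma dstxx u : dst u u = 0. Proof. by apply/eqP; rewrite dst_eq0. Qed.

Definition lip1 (phi : X -> nat) := forall u v, phi u <= phi v + dst u v.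

(** McShane extension of [lab] from [U] to the whole space, truncated at [a]. *)
Lemma lip_extension (U : pred X) (lab : X -> nat) (a : nat) :
  (forall u, U u -> lab u <= a) ->
  (forall u v, U u -> U v -> lab u <= lab v + dst u v) ->
  exists phi, [/\ lip1 phi, forall v, phi v <= a & forall u, U u -> phi u = lab u].
Proof.
move=> laba lablip.
pose p v t := `[< t = a \/ exists2 u, U u & t = lab u + dst u v >].
have exp v : exists t, p v t by exists a; apply/asboolP; left.
pose phi v := ex_minn (exp v).
have phimin v t : p v t -> phi v <= t by rewrite /phi; case: ex_minnP => m _; apply.
have phia v : phi v <= a by apply: phimin; apply/asboolP; left.
have phip v : p v (phi v) by rewrite /phi; case: ex_minnP.
exists phi; split => // [u v|u Uu].
- have /asboolP[->|[w Uw ->]] := phip v; first exact: leq_trans (phia u) (leq_addr _ _).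
  apply: (@leq_trans (lab w + dst w u)).
    by apply: phimin; apply/asboolP; right; exists w.
  by rewrite -addnA leq_add2l (dstC u) dst_tri.
- apply/eqP; rewrite eqn_leq; apply/andP; split.
    by apply: phimin; apply/asboolP; right; exists u => //; rewrite dstxx addn0.
  have /asboolP[->|[w Uw ->]] := phip u; first exact: laba.
  by rewrite dstC lablip.
Qed.

(** The number of [v] within distance [R] of [u] such that [P u v]. *)
Definition degree (R : nat) P u := \sum_(v <- cball u R | P u v) 1.

(** The number of pairs of [P] whose first point is in the ball of radius [T]
    around [x]. *)
Definition paircount (R : nat) P x (T : nat) := \sum_(u <- cball x T) degree R P u.

Section Round.
Context (P : rel X) (Q a s r R M : nat).
Hypotheses (Psym : symmetric P) (PrR : forall u v, P u v -> 2 * r < dst u v <= R).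
Hypotheses (Q0 : 0 < Q) (Qs : Q * s <= a) (QMr : (Q * M).+1 * a <= r).
Hypothesis few : forall x, paircount R P x r < 2 ^ M.

Let deg := degree R P.

(** The status of a point during the carving is 0 if it is undecided, 1 if it
    belongs to a shell, and [m.+2] if it belongs to a core with label [m]. The step
    [carve st x i m] decides the undecided points in the ball of radius [i + a]
    around [x]: those at distance at most [i] from [x] form a core with label [m],
    the other ones a shell. *)
Definition carve (st : X -> nat) x (i m : nat) (v : X) : nat :=
  if (st v == 0) && (dst x v <= i + a) then
    if dst x v <= i then m.+2 else 1
  else st v.

(** The number of pairs of [P] starting at [u] that are charged to the step from
    [st] to [st'] which decides [u]: all of them if [u] is in the shell, otherwise
    those leading to an earlier core with the same label. *)
Definition conflicts (st st' : X -> nat) u :=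
  if st' u == 1 then deg u
  else \sum_(v <- cball u R | P u v && (st v == st' u)) 1.

(** The inner radius is a multiple of [a] chosen by region growing, the label is
    chosen by the pigeonhole principle. *)
Lemma carve_step (st : X -> nat) x : exists im : nat * nat,
  let st' := carve st x im.1 im.2 in
  [/\ im.1 + a <= r, im.2 < Q &
     Q * (\sum_(u <- cball x (im.1 + a) | st u == 0) conflicts st st' u) <=
     2 * \sum_(u <- cball x (im.1 + a) | st u == 0) deg u].
Proof.
pose f j := \sum_(u <- cball x (j * a) | st u == 0) deg u.
have fm : {homo f : i j / i <= j}.
  move=> i j ij; apply: leq_sum_sub => [|u]; first exact: cball_uniq.
  rewrite !mem_cball => di ->; rewrite andbT.
  by apply: (leq_trans di); rewrite leq_mul2r ij orbT.
have [||j jM fj] := @small_increment f Q M fm => //.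
  apply: leq_ltn_trans (few x); apply: leq_sum_sub => [|u]; first exact: cball_uniq.
  by rewrite !mem_cball => /leq_trans ->.
pose i := j * a; pose S := cball x (i + a).
have fjS : f j.+1 = \sum_(u <- S | st u == 0) deg u by rewrite /f mulSn addnC.
pose core := \sum_(u <- S | (st u == 0) && (dst x u <= i)) deg u.
pose shell := \sum_(u <- S | (st u == 0) && ~~ (dst x u <= i)) deg u.
have cs : f j.+1 = core + shell by rewrite fjS (bigID (fun u => dst x u <= i)).
have fcore : f j <= core.
  apply: leq_sum_sub => [|u]; first exact: cball_uniq.
  rewrite !mem_cball => di ->; rewrite di !andbT; lia.
pose cnt m := \sum_(u <- S | (st u == 0) && (dst x u <= i))
                \sum_(v <- cball u R | P u v && (st v == m.+2)) 1.
have [||m mQ cm] := @pigeonhole_sum cnt Q core => //.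
  rewrite /cnt exchange_big leq_sum //= => u _.
  rewrite /deg /degree (eq_bigr (fun m : 'I_Q =>
    \sum_(v <- cball u R | P u v) (st v == m.+2 : nat))); last first.
    by move=> m _; rewrite big_mkcondr; apply: eq_bigr => v _; case: eqP.
  rewrite exchange_big leq_sum //= => v _.
  rewrite (eq_bigr (fun m : 'I_Q => if m.+2 == st v then 1 else 0)); last first.
    by move=> m _; rewrite eq_sym; case: eqP.
  rewrite -big_mkcond sum1_card; apply/card_le1_eqP => /= m m'.
  by rewrite !unfold_in /= => /eqP em /eqP em'; apply: ord_inj; lia.
exists (i, m); split => //=.
  apply: leq_trans QMr; rewrite /i -mulSnr leq_mul2r; apply/orP; right.
  by rewrite ltnS.
rewrite -/S -fjS (bigID (fun u => dst x u <= i)) /= mulnDr.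
have -> : \sum_(u <- S | (st u == 0) && (dst x u <= i)) conflicts st (carve st x i m) u = cnt m.
  apply: eq_bigr => u /andP[u0 ui]; rewrite /conflicts /carve u0 /= ui.
  by rewrite (leq_trans ui (leq_addr _ _)).
have -> : \sum_(u <- S | (st u == 0) && ~~ (dst x u <= i)) conflicts st (carve st x i m) u = shell.
  rewrite /S big_seq_cond [shell]big_seq_cond; apply: eq_bigr => u.
  rewrite mem_cball => /andP[uS /andP[u0 ui]]; rewrite /conflicts /carve u0 /= uS.
  by rewrite (negbTE ui).
have : Q * shell <= f j.+1 by apply: leq_trans fj; rewrite leq_mul2l; lia.
lia.
Qed.

Lemma carving : exists (st : nat -> X -> nat) (im : nat -> nat * nat),
  [/\ forall v, st 0 v = 0, forall k, st k.+1 = carve (st k) (en X k) (im k).1 (im k).2 &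
   forall k, [/\ (im k).1 + a <= r, (im k).2 < Q &
     Q * (\sum_(u <- cball (en X k) ((im k).1 + a) | st k u == 0) conflicts (st k) (st k.+1) u) <=
     2 * \sum_(u <- cball (en X k) ((im k).1 + a) | st k u == 0) deg u]].
Proof.
have [g gP] := choice (fun stx : (X -> nat) * X => carve_step stx.1 stx.2).
pose st := fix st k := if k is k'.+1 then
  let im := g (st k', en X k') in carve (st k') (en X k') im.1 im.2 else fun=> 0.
exists st, (fun k => g (st k, en X k)); split => // k; exact: (gP (st k, en X k)).
Qed.

(** One round: a new coordinate deals with all but a small proportion, in every
    region of the space, of the pairs of [P]. *)
Lemma separation_round : exists phi : X -> nat,
  [/\ lip1 phi, forall v, phi v <= a &
   forall x T, Q * paircount R
      (fun u v => [&& P u v, phi u < phi v + s & phi v < phi u + s]) x T <=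
     4 * paircount R P x (T + R + 2 * r)].
Proof.
have [st [im [st0 stS imP]]] := carving.
(* [c k] is the centre of step [k], [K v] the step that decides [v], and [tau v]
   the final status of [v]. *)
pose c k : X := en X k.
have keep k v : st k v != 0 -> st k.+1 v = st k v.
  by rewrite stS /carve => /negbTE->.
have keeps k l v : k <= l -> st k v != 0 -> st l v = st k v.
  move=> /subnKC <- vk; elim: (l - k) => [|e IH]; first by rewrite addn0.
  by rewrite addnS keep IH.
have exK v : exists k, st k.+1 v != 0.
  have [k kv] := en_surj v; exists k; rewrite stS kv /carve dstxx /=.
  by case: ifP => //; rewrite andbT => /negbT.
pose K v := ex_minn (exK v).
have KS v : st (K v).+1 v != 0 by rewrite /K; case: ex_minnP.
have K0 v k : k <= K v -> st k v = 0.
  rewrite /K; case: ex_minnP => m _ mmin; case: k => [|k] km; first exact: st0.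
  by apply/eqP/negP => /negP /mmin; rewrite leqNgt km.
pose tau v := st (K v).+1 v.
have tauE v k : K v < k -> st k v = tau v by move=> /keeps ->.
have decided v : [/\ dst (c (K v)) v <= (im (K v)).1 + a &
    tau v = if dst (c (K v)) v <= (im (K v)).1 then (im (K v)).2.+2 else 1].
  have := KS v; rewrite /tau stS /carve K0 //= -/(c _).
  by case: ifP.
have tauQ v : tau v <= Q.+1.
  by have [_ ->] := decided v; have [_ + _] := imP (K v); case: ifP; lia.
have core v : 1 < tau v -> dst (c (K v)) v <= (im (K v)).1.
  by have [_ ->] := decided v; case: ifP.
(* A core is at distance more than [a] from all the points decided later. *)
have sep u v : K u < K v -> 1 < tau u -> a < dst u v.
  move=> Kuv /core ui.
  have := K0 v _ Kuv; rewrite stS /carve K0 ?(ltnW Kuv) //= -/(c _).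
  case: (leqP (dst (c (K u)) v)) => [_|+ _]; first by case: ifP.
  by have := dst_tri (c (K u)) u v; lia.
have tau_sep u v : 1 < tau u -> 1 < tau v -> tau u != tau v -> a < dst u v.
  move=> tu tv; case: (ltngtP (K u) (K v)) => [/sep/(_ tu)//|/sep/(_ tv)|Kuv].
    by rewrite dstC.
  have [_ eu] := decided u; have [_ ev] := decided v.
  move: eu ev; rewrite (core _ tu) (core _ tv) Kuv => -> ->; by rewrite eqxx.
have sameK u v : K u = K v -> dst u v <= 2 * r.
  move=> Kuv; have [du _] := decided u; have [dv _] := decided v.
  have [ir _ _] := imP (K v); rewrite Kuv in du.
  by have := dst_tri u (c (K v)) v; rewrite (dstC u (c _)); lia.
have [u Uu|u v Uu Uv|phi [phil phia phiE]] :=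
  @lip_extension (fun u => 1 < tau u) (fun u => (tau u - 2) * s) a.
- by apply: leq_trans Qs; rewrite leq_mul2r; have := tauQ u; lia.
- have [->|ne] := eqVneq (tau u) (tau v); first exact: leq_addr.
  have duv := tau_sep _ _ Uu Uv ne.
  apply: leq_trans (leq_addl _ _); apply: leq_trans (ltnW duv).
  by apply: leq_trans Qs; rewrite leq_mul2r; have := tauQ u; lia.
exists phi; split => // x T.
set P' := fun u v => _.
(* A pair of [P'] is charged to the end that is in a shell, or to the end that
   is decided last. *)
pose ch u v := P u v && ((tau u == 1) || [&& tau u == tau v & K v < K u]).
have P'ch u v : P' u v -> ch u v || ch v u.
  move=> /and3P[Puv p1 p2]; rewrite /ch (Psym v u) Puv /=.
  have t1 w : tau w != 1 -> 1 < tau w by have := KS w; rewrite -/(tau w); lia.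
  have [//|/t1 tu] := eqVneq (tau u) 1.
  have [//|/t1 tv] := eqVneq (tau v) 1; rewrite ?orbT //=.
  have [e|ne] := eqVneq (tau u) (tau v); last first.
    by move: p1 p2; rewrite !phiE //; move: ne tu tv; clear; nia.
  case: (ltngtP (K u) (K v)) => // /sameK.
  by have /andP[] := PrR Puv; lia.
pose cc u := \sum_(v <- cball u R | ch u v) 1.
have cc_bound y S : Q * \sum_(u <- cball y S) cc u <= 2 * paircount R P y (S + 2 * r).
  (* The points decided at a given step lie within distance [2 * r] of each other,
     so the bound of each step that meets the ball can be summed. *)
  have ind N : Q * \sum_(u <- cball y S | K u < N) cc u <=
      2 * \sum_(u <- cball y (S + 2 * r) | K u < N) deg u.
    elim: N => [|N IH]; first by rewrite big_pred0 ?muln0.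
    rewrite (bigID (fun u => K u == N)) [X in _ <= 2 * X](bigID (fun u => K u == N)) /=.
    have E u : (K u < N.+1) && (K u != N) = (K u < N) by lia.
    have E' u : (K u < N.+1) && (K u == N) = (K u == N) by lia.
    rewrite (eq_bigl _ _ E) [X in _ <= 2 * (_ + X)](eq_bigl _ _ E).
    rewrite (eq_bigl _ _ E') [X in _ <= 2 * (X + _)](eq_bigl _ _ E') !mulnDr.
    apply: leq_add => //.
    have [/hasP[u0 u0B /eqP Ku0]|/hasPn none] := boolP (has (fun u => K u == N) (cball y S)).
      have [ir _ stepN] := imP N; move: stepN.
      set D := cball _ _ => stepN.
      have inD u : K u = N -> u \in D.
        by move=> KN; rewrite /D mem_cball; have [] := decided u; rewrite KN.
      apply: (@leq_trans (Q * \sum_(u <- D | st N u == 0) conflicts (st N) (st N.+1) u)).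
        rewrite leq_mul2l; apply/orP; right.
        apply: (@leq_trans (\sum_(u <- cball y S | K u == N) conflicts (st N) (st N.+1) u)).
          apply: leq_sum => u /eqP KN; rewrite /conflicts tauE ?KN // /cc /ch.
          case: eqVneq => [_|t1] /=.
            apply: leq_sum_sub => [|v -> /=]; first exact: cball_uniq.
            by rewrite andbT.
          apply: leq_sum_sub => [|v -> /=]; first exact: cball_uniq.
          by move=> /and3P[-> /eqP-> Kv]; rewrite tauE -?KN //=.
        apply: leq_sum_sub => [|u _ /eqP KN]; first exact: cball_uniq.
        by rewrite inD //= K0 // KN.
      apply: (leq_trans stepN); rewrite leq_mul2l /=.
      apply: leq_sum_sub => [|u uD /eqP uN]; first exact: cball_uniq.
      have KN : K u = N.
        have [lt|lt|//] := ltngtP (K u) N.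
          by have := KS u; rewrite -/(tau u) -(tauE _ _ lt) uN.
        by have := K0 u _ lt; rewrite stS /carve uN /=; move: uD; rewrite /D mem_cball => ->; case: ifP.
      rewrite KN eqxx andbT mem_cball; move: u0B; rewrite mem_cball.
      by have := dst_tri y u0 u; have := sameK u0 u; rewrite KN Ku0 => /(_ erefl); lia.
    rewrite big_seq_cond big_pred0 ?muln0 // => u.
    by apply/negP => /andP[/none /negP].
  have leK u : u \in cball y S -> K u < (\max_(u <- cball y S) K u).+1.
    by move=> uB; rewrite ltnS; apply: (@leq_bigmax_seq _ _ xpredT).
  apply: (@leq_trans (Q * \sum_(u <- cball y S | K u < (\max_(u <- cball y S) K u).+1) cc u)).
    rewrite leq_mul2l; apply/orP; right.
    apply: leq_sum_sub => [|u uB _]; first exact: cball_uniq.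
    by rewrite uB leK.
  apply: leq_trans (ind _) _; rewrite leq_mul2l /=.
  by apply: leq_sum_sub => [|u -> //]; exact: cball_uniq.
have swap : \sum_(u <- cball x T) \sum_(v <- cball u R | ch v u) 1 <=
    \sum_(v <- cball x (T + R)) cc v.
  rewrite /cc (eq_big_seq (fun u => \sum_(v <- cball u R) (ch v u : nat))); last first.
    by move=> u _; rewrite big_mkcond; apply: eq_bigr => v _; case: (ch v u).
  apply: (@leq_trans (\sum_(u <- cball x T) \sum_(v <- cball x (T + R) | dst u v <= R) (ch v u : nat))).
    rewrite big_seq [leqRHS]big_seq; apply: leq_sum => u; rewrite mem_cball => uT.
    apply: leq_sum_sub => [|v]; first exact: cball_uniq.
    by rewrite !mem_cball => uv _; rewrite uv andbT; have := dst_tri x u v; lia.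
  under eq_bigr do rewrite big_mkcond.
  rewrite exchange_big /=; apply: leq_sum => v _.
  rewrite -big_mkcond /=.
  have -> : \sum_(u <- cball x T | dst u v <= R) (ch v u : nat) =
            \sum_(u <- cball x T | (dst u v <= R) && ch v u) 1.
    by rewrite big_mkcondr; apply: eq_bigr => u _; case: (ch v u).
  apply: leq_sum_sub => [|u uT /andP[uv ->]]; first exact: cball_uniq.
  by rewrite mem_cball dstC uv.
have main : paircount R P' x T <= \sum_(u <- cball x T) cc u + \sum_(v <- cball x (T + R)) cc v.
  apply: leq_trans (leq_add (leqnn _) swap); rewrite -big_split /=.
  apply: leq_sum => u _; rewrite /degree /cc.
  rewrite big_mkcond [X in _ <= X + _]big_mkcond [X in _ <= _ + X]big_mkcond -big_split /=.
  by apply: leq_sum => v _; have := @P'ch u v; case: (P' u v) => // /(_ isT); case: (ch u v); case: (ch v u).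
have e1 : \sum_(u <- cball x T) cc u <= \sum_(v <- cball x (T + R)) cc v.
  apply: leq_sum_sub => [|u]; first exact: cball_uniq.
  by rewrite !mem_cball => uT _; rewrite andbT; lia.
have := cc_bound x (T + R).
have : Q * paircount R P' x T <= Q * (2 * \sum_(v <- cball x (T + R)) cc v).
  by rewrite leq_mul2l; lia.
lia.
Qed.

End Round.

(** [phi] does not separate [u] from [v] by [s]. *)
Definition unsep (s : nat) (phi : X -> nat) u v :=
  (phi u < phi v + s) && (phi v < phi u + s).

Lemma unsep_sym s phi : symmetric (unsep s phi).
Proof. by move=> u v; rewrite /unsep andbC. Qed.

Lemma leq_degree R P P' u : subrel P P' -> degree R P u <= degree R P' u.
Proof. by move=> s; apply: leq_sum_sub (cball_uniq _ _) _ => v -> /s ->. Qed.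

Lemma leq_paircount R P P' x T : subrel P P' -> paircount R P x T <= paircount R P' x T.
Proof. by move=> s; apply: leq_sum => u _; apply: leq_degree. Qed.

(** Iterating [separation_round] until no pair is left. *)
Lemma separating_functions (P : rel X) (Q a s r R M n : nat) :
  symmetric P -> (forall u v, P u v -> 2 * r < dst u v <= R) ->
  0 < Q -> Q * s <= a -> (Q * M).+1 * a <= r ->
  (forall x, paircount R P x r < 2 ^ M) ->
  (forall x, 4 ^ n * paircount R P x (n * (R + 2 * r)) < Q ^ n) ->
  exists phi : nat -> X -> nat, [/\ forall i, lip1 (phi i), forall i v, phi i v <= a &
    forall u v, P u v -> exists2 i, i < n & ~~ unsep s (phi i) u v].
Proof.
move=> Psym PrR Q0 Qs QMr few few_n.
pose left (phi : nat -> X -> nat) k u v :=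
  P u v && [forall i : 'I_k, unsep s (phi i) u v].
have leftP phi k : subrel (left phi k) P by move=> u v /andP[].
have [phi [phil phia phiN]] : exists phi : nat -> X -> nat,
    [/\ forall i, lip1 (phi i), forall i v, phi i v <= a &
     forall x T, Q ^ n * paircount R (left phi n) x T <=
                 4 ^ n * paircount R P x (T + n * (R + 2 * r))].
  elim: n {few_n} => [|n [phi [phil phia phiN]]].
    exists (fun _ _ => 0); split => // x T.
    by rewrite !expn0 !mul1n addn0; apply: leq_paircount.
  have [||x|psi [psil psia psiN]] := @separation_round (left phi n) Q a s r R M _ _ Q0 Qs QMr.
  - move=> u v; rewrite /left Psym; congr andb.
    by apply: eq_forallb => i; rewrite unsep_sym.
  - by move=> u v /leftP /PrR.
  - by apply: leq_ltn_trans (few x); apply: leq_paircount.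
  pose phi' i := if i < n then phi i else psi.
  exists phi'; split => [i|i v|x T]; rewrite /phi'; try by case: ifP.
  apply: (@leq_trans (Q ^ n * (Q * paircount R
      (fun u v => [&& left phi n u v, psi u < psi v + s & psi v < psi u + s]) x T))).
    rewrite mulnA -expnSr leq_mul2l; apply/orP; right; apply: leq_paircount => u v.
    rewrite /left => /andP[-> /forallP c]; apply/andP; split.
      by apply/forallP => i; have := c (widen_ord (leqnSn n) i); rewrite /= ltn_ord.
    by have := c ord_max; rewrite /= ltnn.
  apply: (@leq_trans (Q ^ n * (4 * paircount R (left phi n) x (T + R + 2 * r)))).
    by rewrite leq_mul2l psiN orbT.
  rewrite mulnCA expnS -mulnA leq_mul2l /=.
  by apply: leq_trans (phiN _ _) _; rewrite mulSn !addnA.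
(* A pair that is left would be counted in the ball of radius 0 at its origin. *)
exists phi; split => // u v Puv.
have : left phi n u v = false.
  apply/negP => luv.
  have := phiN u 0; rewrite add0n leqNgt => /negP; apply.
  apply: (leq_trans (few_n u)); rewrite leq_pmulr // /paircount.
  have : u \in cball u 0 by rewrite mem_cball dstxx.
  move=> /(big_rem _) -> /=; rewrite /degree.
  have : v \in cball u R by rewrite mem_cball; case/andP: (PrR _ _ Puv).
  by move=> /(big_rem _) -> /=; rewrite luv.
rewrite /left Puv /= => /negbT /forallPn[i ci]; by exists i.
Qed.

Section Scale.
Context (D t0 : nat).
Hypothesis growthD : forall x t, t0 <= t -> size (cball x t) <= t.+1 ^ D.

Lemma leq_paircount_growth P R x T B : t0 <= T < B -> t0 <= R < B ->
  paircount R P x T <= B ^ (2 * D).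
Proof.
move=> /andP[tT TB] /andP[tR RB].
apply: (@leq_trans (\sum_(u <- cball x T) B ^ D)).
  apply: leq_sum => u _; rewrite /degree sum1_count.
  apply: leq_trans (count_size _ _) _; apply: leq_trans (growthD _ tR) _.
  by case: (D) => // D'; rewrite leq_exp2r.
rewrite big_const_seq count_predT iter_addn_0 mulnC mul2n -addnn expnD leq_mul2r.
apply/orP; right; apply: leq_trans (growthD _ tT) _.
by case: (D) => // D'; rewrite leq_exp2r.
Qed.

(** With [Q = 2 ^ h], a number of 1-Lipschitz functions depending on [D] and [p]
    only, not on [h], separates all points at distance in [Q ^ p.+3, Q ^ p.+4]. *)
Lemma single_scale (p h : nat) (n := (2 * (p + 5) * D).+1) (Q := 2 ^ h) :
  t0 + 2 * n + 8 <= h ->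
  exists phi : nat -> X -> nat,
  [/\ forall i, lip1 (phi i), forall i v, phi i v <= Q ^ p.+1 &
    forall u v, Q ^ p.+3 <= dst u v <= Q ^ p.+4 ->
      exists2 i, i < n & ~~ unsep (Q ^ p) (phi i) u v].
Proof.
move=> hh.
have hQ : h < Q by apply: ltn_expl.
pose M := 2 ^ (h - 2); have QM : Q = 4 * M.
  by rewrite /Q /M (_ : 4 = 2 ^ 2) // -expnD subnKC //; lia.
pose a := Q ^ p.+1; pose r := (Q * M).+1 * a; pose R := Q ^ p.+4.
have Q0 : 0 < Q by lia.
have M0 : 0 < M by lia.
have aQ : Q <= a by rewrite /a expnS leq_pmulr // expn_gt0 Q0.
have r2 : 2 * r < Q ^ p.+3.
  rewrite (_ : Q ^ p.+3 = Q * Q * a); last by rewrite /a !expnS; lia.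
  have a0 : 0 < a by lia.
  by rewrite /r QM mulnA ltn_pmul2r //; nia.
have RE : R = Q * Q ^ p.+3 by rewrite /R expnS.
have rR : 2 * r < R by apply: leq_trans r2 _; rewrite RE leq_pmull.
pose B := Q ^ (p + 5); have BE : B = Q * R by rewrite /B /R addnC expnS.
have tr : t0 <= r < B.
  have -> : t0 <= r by apply: (@leq_trans a); [lia|rewrite /r leq_pmull].
  by apply: (@leq_trans R); [lia|rewrite BE leq_pmull].
have R0 : 0 < R by lia.
have tR : t0 <= R < B.
  have -> : t0 <= R by lia.
  by rewrite BE ltn_Pmull //; lia.
have sq : h * h <= M.
  rewrite /M; move: hh; clear; move: (t0) => t hh.
  have : 8 <= h by lia.
  elim: h {hh} => // h IH; rewrite leq_eqVlt => /predU1P[<- //|h8].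
  by rewrite subSn ?expnS; [have := IH h8; move: (2 ^ _) => e; nia|lia].
have BD : B ^ (2 * D) = Q ^ (n.-1) by rewrite /B -expnM; congr (_ ^ _); rewrite /n; lia.
pose P : rel X := fun u v => Q ^ p.+3 <= dst u v <= R.
(* [a] is the thickness of the shells, [r] bounds the radii of the carved balls,
   and [2 * r < Q ^ p.+3] puts the two ends of a pair in different steps. *)
have [|u v /andP[d1 d2]||||x|x|phi [? ? sep]] := @separating_functions P Q a (Q ^ p) r R M n.
- by move=> u v; rewrite /P dstC.
- by rewrite d2 andbT; lia.
- by [].
- by rewrite /a expnS.
- by [].
- apply: leq_ltn_trans (leq_paircount_growth _ _ tr tR) _.
  rewrite BD /Q -expnM ltn_exp2l //; apply: leq_trans sq.
  by rewrite ltn_pmul2l; lia.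
- apply: (@leq_ltn_trans (4 ^ n * B ^ (2 * D))).
    rewrite leq_mul2l; apply/orP; right; apply: leq_paircount_growth => //.
    have n0 : 0 < n by [].
    have n2 : n * 2 <= Q by lia.
    apply/andP; split.
      by case/andP: tR => tR _; apply: leq_trans tR _; apply: leq_trans (leq_pmull _ n0); lia.
    apply: (@leq_trans (n * 2 * R)); last by rewrite BE leq_mul2r n2 orbT.
    by rewrite -mulnA ltn_pmul2l //; lia.
  rewrite BD (expnS Q n.-1) -[in leqRHS](@prednK n) // ltn_pmul2r ?expn_gt0 ?Q0 //.
  by rewrite (_ : 4 = 2 ^ 2) // -expnM ltn_exp2l //; lia.
- by exists phi.
Qed.

End Scale.
End Space.

(** * Bounded colourings *)

Section Colouring.
Context (X : lfspace) (r N : nat).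
Hypothesis ballN : forall x : X, (size (cball x r) <= N)%N.

(** A greedy colouring along the enumeration. *)
Lemma bounded_colouring : exists chi : X -> nat,
  (forall u, (chi u <= N.+1)%N) /\
  (forall u v, u != v -> (dst u v <= r)%N -> chi u != chi v).
Proof.
have fresh (st : X -> nat) (x : X) : exists m,
    (m <= N)%N && (m.+1 \notin map st (cball x r)).
  apply: contrapT => nex.
  have sub : {subset iota 1 N.+1 <= map st (cball x r)}.
    move=> [|m]; rewrite mem_iota //= add1n ltnS => mN.
    by apply: contrapT => /negP h; apply: nex; exists m; rewrite h andbT -ltnS.
  have := uniq_leq_size (iota_uniq _ _) sub.
  by rewrite size_iota size_map => /leq_trans /(_ (ballN x)); rewrite ltnn.
have [g gP] := choice (fun stx : (X -> nat) * X => fresh stx.1 stx.2).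
(* The colour 0 stands for a point that is not coloured yet. *)
pose st := fix st k := if k is k'.+1 then
  fun v => if (v == en X k') && (st k' v == 0%N) then (g (st k', v)).+1 else st k' v
  else fun=> 0%N.
have keeps k l v : (k <= l)%N -> st k v != 0%N -> st l v = st k v.
  move=> /subnKC <- vk; elim: (l - k)%N => [|i IH]; first by rewrite addn0.
  by rewrite addnS /= IH (negbTE vk) andbF.
have inv k : (forall u, st k u <= N.+1)%N /\
    (forall u v, st k u != 0%N -> st k v != 0%N -> u != v -> (dst u v <= r)%N ->
      st k u != st k v).
  elim: k => [//|k [le sep]]; have gE x := gP (st k, x).
  have new u v : st k v != 0%N -> (dst u v <= r)%N -> (g (st k, u)).+1 != st k v.
    move=> v0 duv; apply: contraNN (andP (gE u)).2 => /eqP -> /=.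
    by apply: map_f; rewrite mem_cball.
  split => [u|u v] /=; first by case: ifP => // _; case/andP: (gE u).
  case: ifP => [/andP[/eqP-> _]|_]; case: ifP => [/andP[/eqP-> _]|_].
  - by rewrite eqxx.
  - by move=> _ v0 _ duv; apply: new.
  - by move=> u0 _ _ duv; rewrite eq_sym; apply: new; rewrite // dstC.
  - exact: sep.
have ex v : exists k, st k v != 0%N.
  have [k kv] := en_surj v; exists k.+1 => /=.
  by rewrite kv eqxx /=; case: ifPn.
pose K v := xchoose (ex v).
have KP v : st (K v) v != 0%N := xchooseP (ex v).
exists (fun v => st (K v) v); split => [u|u v uv duv]; first by have [] := inv (K u).
have [_ sep] := inv (maxn (K u) (K v)).
have eu := keeps _ _ _ (leq_maxl (K u) (K v)) (KP u).
have ev := keeps _ _ _ (leq_maxr (K u) (K v)) (KP v).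
by rewrite -eu -ev; apply: sep; rewrite ?eu ?ev.
Qed.

End Colouring.

(** * The graph metric *)

Section GraphMetric.
Context (G : sgraph).
Hypothesis Gconn : gconnected G.
Implicit Types (u v w : G).

Lemma gdistP u v : walk (gdist u v) u v /\ forall j, walk j u v -> (gdist u v <= j)%N.
Proof.
have [_ /(_ u v)[k0 k0w]] := Gconn.
have ex : exists k, `[< walk k u v >] by exists k0; apply/asboolP.
have [m /asboolP mw mmin] := ex_minnP ex.
rewrite /gdist; case: xgetP => [k _ []//|/(_ m)]; case; split => // j jw.
by apply: mmin; apply/asboolP.
Qed.

Lemma gdist_walk u v : walk (gdist u v) u v. Proof. by have [] := gdistP u v. Qed.

Lemma gdist_le u v k : walk k u v -> (gdist u v <= k)%N.
Proof. by have [_] := gdistP u v; apply. Qed.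

Lemma walk_cat i j u v w : walk i u v -> walk j v w -> walk (i + j) u w.
Proof.
move=> [p [pp lp sp]] [q [pq lq sq]]; exists (p ++ q).
by rewrite cat_path last_cat size_cat pp lp pq lq sp sq.
Qed.

Lemma walk_rev k u v : walk k u v -> walk k v u.
Proof.
move=> [p [pp lp sp]]; exists (rev (belast u p)); split.
- rewrite -lp rev_path; apply: sub_path pp => x y; by rewrite adj_sym.
- by case: p lp {pp sp} => [/= <-//|x p] _; rewrite /= rev_cons last_rcons.
- by rewrite size_rev size_belast.
Qed.

Lemma gdist_eq0 u v : (gdist u v == 0%N) = (u == v).
Proof.
apply/eqP/eqP => [d0|<-].
  by have [[|x p] [_ /= lp sp]] := gdist_walk u v; rewrite // d0 in sp.
by apply/eqP; rewrite -leqn0; apply: gdist_le; exists [::].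
Qed.

Lemma gdistC u v : gdist u v = gdist v u.
Proof. by apply/eqP; rewrite eqn_leq !gdist_le //; apply/walk_rev/gdist_walk. Qed.

Lemma gdist_tri u v w : (gdist u w <= gdist u v + gdist v w)%N.
Proof. by apply: gdist_le; apply: walk_cat; apply: gdist_walk. Qed.

Lemma gballE u r v : gball u r v <-> (gdist u v <= r)%N.
Proof. by split => [[]//|]; split => //; have [_] := Gconn; apply. Qed.

(** All the distances smaller than [gdist u v] are attained on a geodesic. *)
Lemma gdist_geodesic u v k : (k <= gdist u v)%N -> exists w, gdist u w = k.
Proof.
have [m dv] : exists m, gdist u v = m by exists (gdist u v).
rewrite dv; elim: m v dv => [|m IH] v dv; first by rewrite leqn0 => /eqP ->; exists v.
rewrite leq_eqVlt => /predU1P[->|]; first by exists v.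
rewrite ltnS; have [p [pp lp sp]] := gdist_walk u v; rewrite dv in sp.
case/lastP: p pp lp sp => [//|p w].
rewrite rcons_path last_rcons size_rcons => /andP[pp pw] wv [sp].
apply: (IH (last u p)); apply/eqP; rewrite eqn_leq; apply/andP; split.
  by apply: gdist_le; exists p.
rewrite -ltnS -dv; apply: leq_trans (gdist_tri u (last u p) v) _.
rewrite -addn1 leq_add2l; apply: gdist_le; exists [:: v]; split => //=.
by rewrite andbT -wv.
Qed.

End GraphMetric.

(** * Superposition of the scales *)

(** Every large distance [d] belongs to a scale: [P + j] and [2 ^ l] are the
    leading part and the order of magnitude of [log d / P]. *)
Lemma scale_cover (P H d : nat) : (0 < P)%N -> (2 ^ (P * (P * 2 ^ H)) <= d)%N ->
  exists j l, [/\ (j < P)%N, (H <= l)%N &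
    ((2 ^ ((P + j) * 2 ^ l)) ^ P <= d <= (2 ^ ((P + j) * 2 ^ l)) ^ P.+1)%N].
Proof.
move=> P0 dH.
have d0 : (0 < d)%N by apply: leq_trans dH; rewrite expn_gt0.
pose e := trunc_log 2 d; pose y := e %/ P.
have /andP[ed de] : (2 ^ e <= d < 2 ^ e.+1)%N by apply: trunc_log_bounds.
have He : (P * (P * 2 ^ H) <= e)%N.
  by rewrite -ltnS -(@ltn_exp2l 2) //; apply: leq_ltn_trans dH de.
have Hy : (P * 2 ^ H <= y)%N by rewrite /y leq_divRL // mulnC.
have yP0 : (0 < y %/ P)%N.
  by rewrite divn_gt0 //; apply: leq_trans Hy; rewrite leq_pmulr // expn_gt0.
pose l := trunc_log 2 (y %/ P).
have /andP[ly yl] : (2 ^ l <= y %/ P < 2 ^ l.+1)%N by apply: trunc_log_bounds.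
have Hl : (H <= l)%N.
  rewrite -ltnS -(@ltn_exp2l 2) //; apply: leq_ltn_trans yl.
  by rewrite leq_divRL // mulnC.
have l0 : (0 < 2 ^ l)%N by rewrite expn_gt0.
have ly' : (P <= y %/ 2 ^ l)%N by rewrite leq_divRL // mulnC -leq_divRL.
have yl' : (y %/ 2 ^ l < P + P)%N.
  by rewrite ltn_divLR //; move: yl; rewrite ltn_divLR // expnS; lia.
exists (y %/ 2 ^ l - P)%N, l; split => //; first lia.
rewrite subnKC //; apply/andP; split.
  rewrite -expnM; apply: leq_trans ed; rewrite leq_exp2l //.
  apply: leq_trans (leq_divM e P); rewrite leq_mul2r -/y; apply/orP; right.
  exact: leq_divM.
rewrite -expnM; apply: (leq_trans (ltnW de)); rewrite leq_exp2l //.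
have eP : (e < y.+1 * P)%N by rewrite -ltn_divLR.
apply: (leq_trans eP).
have yy : (y.+1 <= (y %/ 2 ^ l).+1 * 2 ^ l)%N by rewrite -ltn_divLR.
apply: (@leq_trans ((y %/ 2 ^ l).+1 * 2 ^ l * P)%N); first by rewrite leq_mul2r yy orbT.
rewrite mulSn mulnDl mulnS addnC [leqRHS]addnC leq_add2l mulnC leq_mul2r.
by rewrite ly' orbT.
Qed.

Local Open Scope ring_scope.

Section Series.
Context (R : realType).
Implicit Types (c : R ^nat).

Lemma sum_half (m : nat) : \sum_(0 <= i < m) (2^-1 : R) ^+ i <= 2.
Proof.
suff -> : \sum_(0 <= i < m) (2^-1 : R) ^+ i = 2 - 2 * 2^-1 ^+ m.
  by rewrite gerBl mulr_ge0 // exprn_ge0 // invr_ge0.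
elim: m => [|m IH]; first by rewrite big_geq // expr0; lra.
by rewrite big_nat_recr //= IH exprS; lra.
Qed.

Lemma cvg_series_half c (M : R) : (forall l, `|c l| <= M * 2^-1 ^+ l) -> cvgn (series c).
Proof.
move=> cM; apply: normed_cvg.
apply: (@series_le_cvg _ _ (geometric M 2^-1)) => [l|l|l|] //=.
- exact: le_trans (cM l).
- by apply: is_cvg_geometric_series; rewrite ger0_norm; lra.
Qed.

Lemma lim_series_dist_le c (z B : R) (k : nat) : cvgn (series c) ->
  (forall N, (k <= N)%N -> `|series c N - z| <= B) -> `|limn (series c) - z| <= B.
Proof.
move=> cc cB.
have h : ((fun N => `|series c N - z|) @ \oo --> `|limn (series c) - z|)%classic.
  by apply: cvg_norm; apply: cvgB => //; apply: cvg_cst.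
apply: (cvgr_to_le h); exists k => // N /=; exact: cB.
Qed.

End Series.

Section Glue.
Context (R : realType) (X : lfspace) (g : nat -> X -> R) (x0 : X).
Hypothesis g_lip : forall l u v, `|g l u - g l v| <= (dst u v)%:R / 4 * 2^-1 ^+ l.

(** The sum of the functions [g l]. Subtracting the values at the base point makes
    the series converge. *)
Definition glue (u : X) : R := limn (series (fun l => g l u - g l x0)).

Lemma glue_cvg u v : cvgn (series (fun l => g l u - g l v)).
Proof. exact: cvg_series_half (g_lip ^~ u ^~ v). Qed.

Lemma glueB u v : glue u - glue v = limn (series (fun l => g l u - g l v)).
Proof.
rewrite /glue -lim_seriesB; try exact: glue_cvg.
by congr (limn (series _)); apply/funext => l /=; rewrite !fctE; lra.
Qed.

Lemma glue_lip u v : `|glue u - glue v| <= (dst u v)%:R / 2.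
Proof.
rewrite glueB -[X in `|X|]subr0; apply: (@lim_series_dist_le _ _ _ _ 0%N (@glue_cvg u v)) => N _.
rewrite subr0 /series /=; apply: le_trans (ler_norm_sum _ _ _) _.
apply: (@le_trans _ _ (\sum_(0 <= l < N) (dst u v)%:R / 4 * 2^-1 ^+ l)).
  exact: ler_sum.
rewrite -mulr_sumr; have := sum_half R N.
by have : 0 <= (dst u v)%:R :> R by []; nra.
Qed.

(** At the scale [k], the lower and the higher scales only perturb [g k]. *)
Lemma glue_separates u v (k : nat) (A : R) :
  4 * A <= `|g k u - g k v| ->
  \sum_(0 <= l < k) `|g l u - g l v| <= A ->
  (forall i, `|g (k.+1 + i)%N u - g (k.+1 + i)%N v| <= A / 2 * 2^-1 ^+ i) ->
  2 * A <= `|glue u - glue v|.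
Proof.
move=> gk low high; rewrite glueB.
have A0 : 0 <= A by apply: le_trans low; apply: sumr_ge0.
have : `|limn (series (fun l => g l u - g l v)) - (g k u - g k v)| <= 2 * A.
  apply: (@lim_series_dist_le _ _ _ _ k.+1 (@glue_cvg u v)) => N kN.
  rewrite /series /= (big_cat_nat (n := k.+1)) //= big_nat_recr //= addrAC addrK.
  apply: le_trans (ler_normD _ _) _; rewrite mulr_natl mulr2n; apply: lerD.
    exact: le_trans (ler_norm_sum _ _ _) low.
  apply: le_trans (ler_norm_sum _ _ _) _.
  rewrite -{1}[k.+1]add0n big_addn.
  apply: (@le_trans _ _ (\sum_(0 <= i < N - k.+1) A / 2 * 2^-1 ^+ i)).
    by apply: ler_sum => i _; rewrite addnC.
  by rewrite -mulr_sumr; have := sum_half R (N - k.+1); nra.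
set L := limn _; move=> LA.
have : `|g k u - g k v| <= `|L| + `|L - (g k u - g k v)|.
  by have := ler_normB L (L - (g k u - g k v)); rewrite subKr.
lra.
Qed.

End Glue.

Section Embedding.
Context (R : realType) (X : lfspace) (D t0 : nat).
Hypothesis growthD : forall (x : X) t, (t0 <= t)%N -> (size (cball x t) <= t.+1 ^ D)%N.

Lemma lip1_norm (phi : X -> nat) u v : lip1 phi ->
  `|(phi u)%:R - (phi v)%:R| <= (dst u v)%:R :> R.
Proof.
move=> lp; have := lp u v; have := lp v u; rewrite (dstC v u) -!(ler_nat R) !natrD.
by rewrite ler_norml; lra.
Qed.

Lemma bounded_norm (phi : X -> nat) a u v : (forall v, phi v <= a)%N ->
  `|(phi u)%:R - (phi v)%:R| <= a%:R :> R.
Proof.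
move=> pa; have := pa u; have := pa v; rewrite -!(ler_nat R).
have : 0 <= (phi u)%:R :> R by []; have : 0 <= (phi v)%:R :> R by [].
by rewrite ler_norml; lra.
Qed.

Lemma not_unsep_norm (phi : X -> nat) s u v : ~~ unsep s phi u v ->
  s%:R <= `|(phi u)%:R - (phi v)%:R| :> R.
Proof.
rewrite /unsep negb_and -!leqNgt -!(ler_nat R) !natrD ler_normr.
by case/orP => h; apply/orP; [left|right]; lra.
Qed.

(** The index [j] selects a sequence of scales, each the square of the previous
    one, and [i] one of the [n] functions given by [single_scale] at each of them. With [p = e + 5], the
    functions of the scale [Q], divided by [Q ^ 5], differ by [Q ^ e] on pairs at
    distance at most [Q ^ (e + 9)]. *)
Lemma coarse_functions (e : nat) (n := (2 * (e + 5 + 5) * D).+1) : (5 <= e)%N ->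
  exists (F : 'I_(e + 8) -> 'I_n -> X -> R) (r0 : nat),
    (forall j i u v, `|F j i u - F j i v| <= (dst u v)%:R / 2) /\
    (forall u v, (r0 <= dst u v)%N -> exists (Q : nat) j i,
       [/\ (8 <= Q)%N, (dst u v <= Q ^ (e + 9))%N &
          Q%:R ^+ e / 2 <= `|F j i u - F j i v|]).
Proof.
move=> e5; pose P := (e + 8)%N.
pose H0 := (t0 + 2 * n + 8)%N.
have single h : exists phi : nat -> X -> nat,
  [/\ forall i, lip1 (phi i), forall i v, (phi i v <= (2 ^ h) ^ (e + 6))%N &
    (H0 <= h)%N -> forall u v, ((2 ^ h) ^ P <= dst u v <= (2 ^ h) ^ P.+1)%N ->
      exists2 i, (i < n)%N & ~~ unsep ((2 ^ h) ^ (e + 5)) (phi i) u v].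
  have [Hh|hH] := leqP H0 h; last by exists (fun _ _ => 0%N).
  have [phi [p1 p2 p3]] := single_scale growthD Hh.
  have e8 : (e + 5).+3 = P by rewrite /P; lia.
  exists phi; split => // [i v|_ u v duv]; first by rewrite addnS p2.
  by apply: p3; rewrite e8.
have [Phi PhiP] := choice single.
pose hh j l := ((P + j) * 2 ^ l)%N; pose q j l := (2 ^ hh j l)%N.
have ql j l : (l < q j l)%N.
  apply: leq_trans (ltn_expl l (isT : 1 < 2)%N) _.
  apply: leq_trans (ltnW (ltn_expl _ (isT : 1 < 2)%N)) _.
  by rewrite /q leq_exp2l // /hh leq_pmull // /P; lia.
pose g j i l u : R := (Phi (hh j l) i u)%:R / (q j l)%:R ^+ 5.
have q0 j l : 0 < (q j l)%:R ^+ 5 :> R.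
  by rewrite exprn_gt0 // ltr0n expn_gt0.
have gE j i l u v : `|g j i l u - g j i l v| =
    `|(Phi (hh j l) i u)%:R - (Phi (hh j l) i v)%:R| / (q j l)%:R ^+ 5.
  by rewrite /g -mulrBl normrM normfV (ger0_norm (ltW (q0 _ _))).
have gd j i l u v : `|g j i l u - g j i l v| <= (dst u v)%:R / (q j l)%:R ^+ 5.
  rewrite gE ler_pM2r ?invr_gt0 //; apply: lip1_norm.
  by have [] := PhiP (hh j l).
have ga j i l u v : `|g j i l u - g j i l v| <= (q j l)%:R ^+ e.+1.
  rewrite gE ler_pdivrMr // -exprD addSnnS -natrX; apply: bounded_norm => w.
  by have [_ + _] := PhiP (hh j l); apply.
have glip j i l u v : `|g j i l u - g j i l v| <= (dst u v)%:R / 4 * 2^-1 ^+ l.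
  apply: le_trans (gd _ _ _ _ _) _; rewrite -mulrA ler_wpM2l //.
  rewrite exprVn -invfM lef_pV2 ?posrE // ?mulr_gt0 ?exprn_gt0 //.
  rewrite -!natrX -natrM ler_nat /q -expnM (_ : 4 = 2 ^ 2)%N // -expnD leq_exp2l //.
  have := ltn_expl l (isT : 1 < 2)%N; rewrite /hh; nia.
exists (fun j i => glue (g j i) (en X 0)), (2 ^ (P * (P * 2 ^ H0)))%N.
split => [j i u v|u v duv]; first by apply: glue_lip => l w w'; apply: glip.
have P0 : (0 < P)%N by rewrite /P; lia.
have [j [l [jP Hl dQ]]] := scale_cover P0 duv.
pose Q := q j l; exists Q, (Ordinal jP).
have hlh : (H0 <= hh j l)%N.
  apply: (leq_trans Hl); apply: leq_trans (ltnW (ltn_expl _ (isT : 1 < 2)%N)) _.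
  by rewrite leq_pmull // addn_gt0 P0.
have [_ _ /(_ hlh u v dQ)[i i_n sep]] := PhiP (hh j l).
exists (Ordinal i_n).
have Q8 : (8 <= Q)%N.
  rewrite /Q /q (_ : 8 = 2 ^ 3)%N // leq_exp2l //; apply: leq_trans hlh.
  by rewrite /H0; lia.
have dQ' : (dst u v <= Q ^ (e + 9))%N by case/andP: dQ; rewrite /P -addnS.
split => //.
have -> : Q%:R ^+ e / 2 = 2 * (Q%:R ^+ e / 4) :> R by lra.
(* The terms of the lower scales are at most [Q ^ (e - 2)], because
   [e + 1 <= 2 * (e - 2)]. The first higher scale is [Q ^ 2], so that the terms of
   the higher ones are at most [Q ^ (e + 9) / Q ^ 10]. *)
apply: (@glue_separates _ _ _ _ _ _ _ l) => [l' w w'|||i'] /=; first exact: glip.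
- rewrite mulrC divfK // gE ler_pdivlMr // -exprD -natrX.
  exact: not_unsep_norm.
- apply: (@le_trans _ _ (\sum_(0 <= l' < l) (Q%:R : R) ^+ (e - 2))).
    rewrite big_nat_cond [leRHS]big_nat_cond; apply: ler_sum => l' /andP[/andP[_ l'l] _].
    apply: le_trans (ga _ _ _ _ _) _; rewrite -!natrX ler_nat /Q /q -!expnM leq_exp2l //.
    have : (2 * hh j l' <= hh j l)%N.
      by rewrite /hh mulnCA leq_mul2l -expnS leq_exp2l // l'l orbT.
    nia.
  rewrite sumr_const_nat subn0 -[leLHS]mulr_natr ler_pdivlMr // -[in leRHS](subnK (_ : 2 <= e)%N); last lia.
  rewrite exprD -mulrA -!natrX -!natrM ler_nat leq_mul2l; apply/orP; right.
  by have := ql j l; rewrite -/Q !expnS; nia.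
- apply: le_trans (gd _ _ _ _ _) _.
  have nat_ineq : (dst u v * (8 * 2 ^ i') <= Q ^ e * q j (l.+1 + i') ^ 5)%N.
    apply: (@leq_trans (Q ^ (e + 9) * (8 * 2 ^ i'))%N); first by rewrite leq_mul2r dQ' orbT.
    rewrite expnD -mulnA leq_mul2l; apply/orP; right.
    apply: (@leq_trans (Q ^ 10 * 2 ^ i')%N).
      by rewrite mulnA leq_mul2r [(Q ^ 10)%N]expnSr leq_mul2l Q8 !orbT.
    rewrite /Q /q -!expnM -expnD leq_exp2l // /hh expnD expnS.
    have := ltn_expl i' (isT : 1 < 2)%N; have : (0 < (P + j) * 2 ^ l)%N.
      by rewrite muln_gt0 addn_gt0 P0 expn_gt0.
    nia.
  rewrite ler_pdivrMr //.
  have w0 : 0 < 2 ^+ i' :> R by rewrite exprn_gt0.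
  rewrite exprVn [leRHS](_ : _ = (Q%:R ^+ e * (q j (l.+1 + i')%N)%:R ^+ 5) / (8 * 2 ^+ i')); last first.
    by move: (2 ^+ i') w0 => w w0; field; rewrite (gt_eqF w0).
  by rewrite ler_pdivlMr ?mulr_gt0 // -!natrX -!natrM ler_nat.
Qed.

End Embedding.

(** * The map to the grid *)

Section Floor.
Context (R : realType).
Implicit Types x y : R.

Lemma absz_floor_le x y : `|Num.floor x - Num.floor y|%N%:R <= `|x - y| + 1.
Proof.
rewrite natr_absz intr_norm rmorphB /=.
have := floor_itv x; have := floor_itv y; rewrite !intrD.
move: (Num.floor x)%:~R (Num.floor y)%:~R => a b /andP[? ?] /andP[? ?].
have := ler_norm (x - y); have := ler_norm (y - x); rewrite (distrC y) => ? ?.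
by rewrite ler_norml; lra.
Qed.

Lemma absz_floor_ge x y : `|x - y| - 1 <= `|Num.floor x - Num.floor y|%N%:R.
Proof.
rewrite natr_absz intr_norm rmorphB /=.
have := floor_itv x; have := floor_itv y; rewrite !intrD.
move: (Num.floor x)%:~R (Num.floor y)%:~R => a b /andP[? ?] /andP[? ?].
have := ler_norm (a - b); have := ler_norm (b - a); rewrite (distrC b) => ? ?.
by rewrite lerBlDr ler_norml; lra.
Qed.

End Floor.

Lemma leq_distinf n (x y : 'rV[int]_n) i : (`|x ord0 i - y ord0 i| <= distinf x y)%N.
Proof. exact: (@leq_bigmax _ (fun i => `|x ord0 i - y ord0 i|%N)). Qed.

Section GridEmbedding.
Context (R : realType) (X : lfspace) (D t0 : nat).
Hypothesis growthD : forall (x : X) t, (t0 <= t)%N -> (size (cball x t) <= t.+1 ^ D)%N.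

(** The coordinates are the integer parts of the [coarse_functions] and a bounded
    colouring, indexed by [None]. *)
Lemma grid_embedding (e : nat) (theta : R)
    (n := ((e + 8) * (2 * (e + 5 + 5) * D).+1).+1) :
  (5 <= e)%N -> theta <= e%:R / (e + 9)%:R ->
  exists f : X -> 'rV[int]_n, [/\ injective f,
    exists K : nat, forall u v, (distinf (f u) (f v) <= maxn (dst u v) K)%N &
    exists r0 : nat, (0 < r0)%N /\ forall u v, (r0 <= dst u v)%N ->
      4^-1 * (dst u v)%:R `^ theta <= (distinf (f u) (f v))%:R].
Proof.
move=> e5 he; have [F [r0 [Flip Fsep]]] := coarse_functions R growthD e5.
pose rho := maxn r0.+1 t0.
have [chi [chiN chiP]] : exists chi : X -> nat,
    (forall u, (chi u <= (rho.+1 ^ D).+1)%N) /\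
    (forall u v, u != v -> (dst u v <= rho)%N -> chi u != chi v).
  by apply: bounded_colouring => x; apply: growthD; rewrite leq_maxr.
pose T := option ('I_(e + 8) * 'I_(2 * (e + 5 + 5) * D).+1)%type.
have cT : #|{: T}| = n by rewrite card_option card_prod !card_ord.
pose h (k : T) u : int :=
  if k is Some (j, i) then Num.floor (F j i u) else (chi u)%:Z.
pose f u : 'rV[int]_n := \row_k h (enum_val (cast_ord (esym cT) k)) u.
have fE u v k : (`|h k u - h k v| <= distinf (f u) (f v))%N.
  have := leq_distinf (f u) (f v) (cast_ord cT (enum_rank k)).
  by rewrite !mxE cast_ordK enum_rankK.
have lower u v : (r0.+1 <= dst u v)%N ->
    4^-1 * (dst u v)%:R `^ theta <= (distinf (f u) (f v))%:R.
  move=> duv; have [Q [j [i [Q8 dQ FQ]]]] := Fsep u v (ltnW duv).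
  have hk := fE u v (Some (j, i)).
  apply: (@le_trans _ _ (`|h (Some (j, i)) u - h (Some (j, i)) v|%N)%:R); last first.
    by rewrite ler_nat.
  apply: le_trans (absz_floor_ge _ _).
  have d1 : 1 <= (dst u v)%:R :> R by rewrite ler1n; apply: leq_trans duv.
  have Q0 : 0 <= Q%:R :> R by [].
  have dt : (dst u v)%:R `^ theta <= Q%:R ^+ e :> R.
    apply: le_trans (ler_powR d1 he) _.
    have le1 : (dst u v)%:R <= Q%:R `^ (e + 9)%:R :> R.
      by rewrite powR_mulrn // -natrX ler_nat.
    apply: le_trans (ge0_ler_powR _ _ _ le1) _; rewrite ?nnegrE ?powR_ge0 //.
    rewrite -powRrM mulrC divfK ?powR_mulrn // pnatr_eq0; lia.
  have Qe : 4 <= Q%:R ^+ e :> R.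
    rewrite -natrX ler_nat; apply: (@leq_trans Q); first lia.
    by rewrite -{1}[Q]expn1 leq_exp2l; lia.
  lra.
exists f; split.
- move=> u v fuv; apply: contrapT => /eqP uv.
  have d0 : distinf (f u) (f v) = 0%N.
    by apply/eqP; rewrite -leqn0; apply/bigmax_leqP => k _; rewrite fuv subrr.
  have [duv|duv] := leqP r0.+1 (dst u v).
    have := lower _ _ duv; rewrite d0; apply/negP; rewrite -ltNge mulr_gt0 ?invr_gt0 //.
    by rewrite powR_gt0 // ltr0n; apply: leq_trans duv.
  have := fE u v None; rewrite d0 leqn0 absz_eq0 subr_eq0 /= eqz_nat.
  apply/negP; apply: chiP => //; apply: leq_trans (leq_maxl _ _); exact: ltnW.
- exists (maxn 2 (rho.+1 ^ D).+1) => u v; apply/bigmax_leqP => k _; rewrite !mxE.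
  case: (enum_val _) => [[j i]|] /=; last first.
    have := chiN u; have := chiN v; lia.
  have : (2 * `|Num.floor (F j i u) - Num.floor (F j i v)| <= dst u v + 2)%N.
    rewrite -(ler_nat R) natrM natrD.
    have := absz_floor_le (F j i u) (F j i v); have := Flip j i u v; lra.
  lia.
- by exists r0.+1.
Qed.

End GridEmbedding.

(** * Growth of graphs *)

Section Limsup.
Context (R : realType).
Implicit Types (u : (\bar R)^nat) (a : \bar R).
Local Open Scope ereal_scope.

Lemma limn_esup_lt u a : limn_esup u < a -> exists N, forall k, (N <= k)%N -> u k < a.
Proof.
move=> /ereal_inf_lt[_ [V [N _ NV] <-]] lt; exists N => k Nk.
by apply: le_lt_trans lt; apply: ereal_sup_ubound; exists k => //; apply: NV.
Qed.

Lemma limn_esup_ge u a N : (forall k, (N <= k)%N -> a <= u k) -> a <= limn_esup u.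
Proof.
move=> au; apply: le_ereal_inf_tmp => _ [V [M _ MV] <-].
apply: le_trans (au (maxn M N) (leq_maxr _ _)) _.
by apply: ereal_sup_ubound; exists (maxn M N) => //; apply: MV; rewrite /= leq_maxl.
Qed.

Lemma limn_esup_le u a N : (forall k, (N <= k)%N -> u k <= a) -> limn_esup u <= a.
Proof.
move=> ua; apply: (@le_trans _ _ (ereal_sup (u @` [set k | (N <= k)%N]%classic))).
  by apply: ereal_inf_lbound; exists [set k | (N <= k)%N]%classic => //; exists N.
by apply: ge_ereal_sup => _ [k /= Nk <-]; apply: ua.
Qed.

End Limsup.

Section Growth.
Context (R : realType) (G : sgraph).
Hypothesis Gconn : gconnected G.

Lemma gball_growth (r : nat) (B : R) : (growth R G r <= B%:E)%E ->
  forall u : G, finite_set (gball u r) /\ (#|` fset_set (gball u r) |)%:R <= B.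
Proof.
move=> gB u; have : (counting (gball u r) <= B%:E)%E.
  by apply: le_trans gB; apply: ereal_sup_ubound; exists u.
by rewrite /counting; case: asboolP => // fin; rewrite lee_fin.
Qed.

Lemma growth_rate_lt (r : nat) (a : R) : (0 < r)%N -> (growth_rate R G r < a%:E)%E ->
  (growth R G r <= (r.+1%:R `^ a)%:E)%E.
Proof.
move=> r0; have r1 : 1 < r.+1%:R :> R by rewrite ltr1n.
have l0 := ln_gt0 r1.
rewrite /growth_rate inver gt_eqF //; case: (growth R G r) => [g| |] /=.
- rewrite lee_fin; case: (leP g 0) => g0.
    by move=> _; apply: le_trans g0 _; apply: powR_ge0.
  rewrite -EFinM lte_fin ltr_pdivrMr // -ln_powR => /ltW.
  by rewrite ler_ln ?posrE // powR_gt0.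
- by rewrite mulyr gtr0_sg ?invr_gt0 // mul1e ltNge leey.
- by move=> _; rewrite leNye.
Qed.

Lemma growth_rate_le (r : nat) (a : R) : (0 < r)%N ->
  (growth R G r <= (r.+1%:R `^ a)%:E)%E -> (growth_rate R G r <= a%:E)%E.
Proof.
move=> r0; have r1 : 1 < r.+1%:R :> R by rewrite ltr1n.
have l0 := ln_gt0 r1.
rewrite /growth_rate inver gt_eqF //; case: (growth R G r) => [g| |] //=.
- rewrite lee_fin; case: (leP g 0) => g0.
    by move=> _; rewrite mulNyr gtr0_sg ?invr_gt0 // mul1e leNye.
  rewrite -EFinM lee_fin ler_pdivrMr // -ln_powR.
  by rewrite ler_ln ?posrE // powR_gt0.
- by move=> _; rewrite mulNyr gtr0_sg ?invr_gt0 // mul1e leNye.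
Qed.

Lemma growth_rate_ge (r : nat) (a : R) : (0 < r)%N ->
  ((r.+1%:R `^ a)%:E <= growth R G r)%E -> (a%:E <= growth_rate R G r)%E.
Proof.
move=> r0; have r1 : 1 < r.+1%:R :> R by rewrite ltr1n.
have l0 := ln_gt0 r1; have p0 : 0 < r.+1%:R `^ a by rewrite powR_gt0.
rewrite /growth_rate inver gt_eqF //; case: (growth R G r) => [g| |] //=.
- rewrite lee_fin => ga; have g0 := lt_le_trans p0 ga; rewrite (leNgt g) g0 /=.
  by rewrite -EFinM lee_fin ler_pdivlMr // -ln_powR ler_ln ?posrE.
- by move=> _; rewrite mulyr gtr0_sg ?invr_gt0 // mul1e leey.
Qed.

Lemma growth_ge (r j : nat) (u v : G) : (j <= r)%N -> (j <= gdist u v)%N ->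
  ((j.+1%:R : R)%:E <= growth R G r)%E.
Proof.
move=> jr juv; apply: (@le_trans _ _ (counting (gball u r))); last first.
  by apply: ereal_sup_ubound; exists u.
rewrite /counting; case: asboolP => [fin|_]; last exact: leey.
rewrite lee_fin ler_nat.
have sub : {subset iota 0 j.+1 <= map (gdist u) (fset_set (gball u r))}.
  move=> k; rewrite mem_iota /= add0n ltnS => kj.
  have [w dw] := gdist_geodesic Gconn (leq_trans kj juv).
  rewrite -dw; apply: map_f; rewrite in_fset_set //; apply: mem_set.
  by apply/(gballE Gconn); rewrite dw; apply: leq_trans jr.
by have := uniq_leq_size (iota_uniq _ _) sub; rewrite size_iota size_map.
Qed.

Context (rho : R).
Hypothesis Grho : asymptotic_growth_rate R G = rho%:E.

Lemma growth_eventually : exists N, forall r, (N <= r)%N ->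
  (growth R G r <= (r.+1%:R `^ (rho + 1))%:E)%E.
Proof.
have [|N NP] := @limn_esup_lt _ (growth_rate R G) (rho + 1)%:E.
  by move: Grho; rewrite /asymptotic_growth_rate => ->; rewrite lte_fin ltrDl.
exists (maxn 1 N) => r; rewrite geq_max => /andP[r0 Nr].
by apply: growth_rate_lt => //; apply: NP.
Qed.

Lemma finite_gball (u : G) (r : nat) : finite_set (gball u r).
Proof.
have [N NP] := growth_eventually.
have [fin _] := gball_growth (NP (maxn N r) (leq_maxl _ _)) u.
apply: sub_finite_set fin => v [uv vr]; split => //.
exact: leq_trans vr (leq_maxr _ _).
Qed.

(** The closed balls of the graph as duplicate-free lists. *)
Definition gballs (u : G) (r : nat) : seq G := fset_set (gball u r).

Lemma gballs_uniq u r : uniq (gballs u r). Proof. exact: fset_uniq. Qed.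

Lemma mem_gballs u r v : (v \in gballs u r) = (gdist u v <= r)%N.
Proof.
rewrite /gballs in_fset_set; last exact: finite_gball.
by apply/idP/idP => [/set_mem/(gballE Gconn)//|?]; apply/mem_set/(gballE Gconn).
Qed.

(** An enumeration of the vertices, possibly with repetitions: [k] encodes a radius
    and a position in the ball of this radius around [x0]. *)
Definition genum (x0 : G) (k : nat) : G :=
  if choice.unpickle k is Some (r, i) then nth x0 (gballs x0 r) i else x0.

Lemma genum_surj x0 v : exists k, genum x0 k = v.
Proof.
exists (choice.pickle (gdist x0 v, index v (gballs x0 (gdist x0 v)))).
by rewrite /genum choice.pickleK nth_index // mem_gballs.
Qed.

(** The metric space of the graph. *)
Definition graph_space (x0 : G) : lfspace :=
  @LFSpace G (@gdist G) (gdist_eq0 Gconn) (gdistC Gconn) (gdist_tri Gconn)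
    gballs gballs_uniq mem_gballs (genum x0) (genum_surj x0).

Lemma graph_growth (D : nat) : rho + 1 <= D%:R -> exists t0, forall (u : G) t,
  (t0 <= t)%N -> (size (gballs u t) <= t.+1 ^ D)%N.
Proof.
move=> rD; have [N NP] := growth_eventually; exists N => u t Nt.
have [_ le] := gball_growth (NP t Nt) u; rewrite -(ler_nat R) natrX.
apply: le_trans le _; rewrite -powR_mulrn //; apply: ler_powR => //.
by rewrite ler1n.
Qed.

(** By [gdist_geodesic], a ball of radius [k] has more than [k] points. *)
Lemma unbounded_rho : (forall B, exists u v : G, (B <= gdist u v)%N) -> 1 <= rho.
Proof.
move=> unb; rewrite -lee_fin -Grho; apply: (@limn_esup_ge _ _ _ 1) => k k1.
have [u [v kuv]] := unb k; apply: growth_rate_ge => //.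
by rewrite powRr1 //; apply: growth_ge kuv.
Qed.

(** If [0 < rho], the number of vertices is at most [k.+1 `^ (rho / 2)] for large
    [k], and the growth rate would be at most [rho / 2]. *)
Lemma bounded_rho (B : nat) : (forall u v : G, (gdist u v <= B)%N) -> rho = 0.
Proof.
move=> bnd; have [x0 _] := Gconn.1.
have rho0 : 0 <= rho.
  rewrite -lee_fin -Grho; apply: (@limn_esup_ge _ _ _ 1) => k k1.
  apply: growth_rate_ge => //; rewrite powRr0.
  exact: (@growth_ge k 0 x0 x0).
apply/eqP; rewrite eq_le rho0 andbT leNgt; apply/negP => rho_gt0.
pose m := size (gballs x0 B).
have gm k : (growth R G k <= (m%:R : R)%:E)%E.
  apply: ge_ereal_sup => _ [u _ <-]; rewrite /counting asboolT; last exact: finite_gball.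
  rewrite lee_fin ler_nat; apply: uniq_leq_size; first exact: gballs_uniq.
  by move=> v _; rewrite mem_gballs.
pose N := (Num.truncn (m%:R `^ (2 / rho) : R)).+1.
suff : (rho%:E <= (rho / 2)%:E)%E by rewrite lee_fin; lra.
rewrite -Grho; apply: (@limn_esup_le _ _ _ N) => k Nk.
apply: growth_rate_le; first exact: leq_trans Nk.
apply: le_trans (gm k) _; rewrite lee_fin.
have mk : m%:R `^ (2 / rho) <= k.+1%:R :> R.
  by apply: (le_trans (ltW (truncnS_gt _))); rewrite ler_nat; apply: leqW.
have -> : m%:R = (m%:R `^ (2 / rho)) `^ (rho / 2) :> R.
  by rewrite -powRrM (_ : _ * _ = 1) ?powRr1 //; field; rewrite gt_eqF.
apply: ge0_ler_powR => //; rewrite ?nnegrE ?powR_ge0 //; lra.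
Qed.

End Growth.

Lemma dimension_bound (R : realType) (rho : R) (a b D : nat) :
  1 <= rho -> D%:R <= 3 * rho ->
  (a * (2 * b * D).+1).+1%:R <= (a * (6 * b).+1).+1%:R * rho.
Proof.
move=> rho1 D3; rewrite -!natr1 !natrM mulrDl mul1r lerD // -mulrA ler_wpM2l //.
rewrite -[(2 * b * D).+1%:R]natr1 -[(6 * b).+1%:R]natr1 !natrM.
have : b%:R * D%:R <= b%:R * (3 * rho) by rewrite ler_wpM2l.
lra.
Qed.

(* In the bound on n, the second alternative only concerns finite graphs, for
   which rho = 0 whereas no injection into Z^0 exists if there are two vertices. *)
Theorem corollary1p9 (R : realType) (eps : R) (eps_gt0 : 0 < eps) :
  exists C : R, forall (G : sgraph) (rho : R),
    gconnected G -> asymptotic_growth_rate R G = rho%:E ->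
    exists (n : nat) (f : G -> 'rV[int]_n),
      [/\ injective f,
          n%:R <= C * rho \/ (rho = 0 /\ (n <= 1)%N),
          exists K : R, forall u v : G,
            (distinf (f u) (f v))%:R <= Num.max (gdist u v)%:R K
        & exists c r0 : R, [/\ 0 < c, 1 <= r0
            & forall u v : G, r0 <= (gdist u v)%:R ->
                c * (gdist u v)%:R `^ (1 - eps) <= (distinf (f u) (f v))%:R]].
Proof.
(* [9 <= eps * (e + 9)], so that [1 - eps <= e / (e + 9)] *)
pose e := ((Num.truncn (9 / eps)).+1 + 5)%N.
have e5 : (5 <= e)%N by rewrite leq_addl.
have he : 1 - eps <= e%:R / (e + 9)%:R.
  have : 9 / eps < (e + 9)%:R.
    by apply: lt_le_trans (truncnS_gt _) _; rewrite ler_nat /e -addnA leq_addr.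
  rewrite ltr_pdivrMr // ler_pdivlMr ?ltr0n ?addn_gt0 // natrD => h; nra.
exists (((e + 8) * (6 * (e + 10)).+1).+1)%:R => G rho Gconn Grho.
have [x0 _] := Gconn.1.
have [[B bnd]|unb] := pselect (exists B, forall u v : G, (gdist u v <= B)%N).
- have rho0 := bounded_rho Gconn Grho bnd.
  have inB u : u \in gballs x0 B by rewrite (mem_gballs Gconn Grho).
  exists 1%N, (fun u => \row_(k < 1) (index u (gballs x0 B))%:Z); split.
  + move=> u v /rowP /(_ ord0); rewrite !mxE => -[iuv].
    by rewrite -(nth_index x0 (inB u)) iuv nth_index.
  + by right.
  + exists (size (gballs x0 B))%:R => u v; rewrite le_max !ler_nat; apply/orP; right.
    apply/bigmax_leqP => i _; rewrite !mxE.
    have := index_size u (gballs x0 B); have := index_size v (gballs x0 B).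
    by move: (size _) (index _ _) (index _ _) => m a b; lia.
  + exists 1, B.+1%:R; split => // [|u v]; first by rewrite ler1n.
    by rewrite ler_nat ltnNge bnd.
- have rho1 : 1 <= rho.
    apply: (unbounded_rho Gconn Grho) => B; apply: contrapT => nex; apply: unb.
    exists B => u v; rewrite leqNgt; apply/negP => lt; apply: nex.
    by exists u, v; apply: ltnW.
  pose D := (Num.truncn (rho + 1)).+1.
  have [t0 growthD] := @graph_growth R G rho Grho D (ltW (truncnS_gt _)).
  have [f [finj [K fK] [r0 [r00 fr]]]] :=
    @grid_embedding R (graph_space Gconn Grho x0) D t0 growthD e (1 - eps) e5 he.
  exists _, f; split => //.
  + left.
    have D3 : D%:R <= 3 * rho.
      have : (Num.truncn (rho + 1))%:R <= rho + 1 by rewrite truncn_le; lra.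
      by rewrite /D -natr1; lra.
    rewrite (_ : e + 10 = e + 5 + 5)%N; last by rewrite -addnA.
    exact: dimension_bound.
  + exists K%:R => u v; rewrite le_max !ler_nat -leq_max; exact: fK.
  + exists 4^-1, r0%:R; split => [||u v]; rewrite ?invr_gt0 ?ler1n //.
    by rewrite ler_nat => /fr.
Qed.
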